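(* Let $A\subseteq B$ be a $C^*$-inclusion. Any $\mathcal{M}_{\mathrm{loc}}$-expectation $E\colon B\to\mathcal{M}_{\mathrm{loc}}(A)$ and, in particular, any genuine conditional expectation $E\colon B\to A$ is supportive.
   Context: A generalised expectation for a $C^*$-inclusion $A\subseteq B$ consists of another $C^*$-inclusion $A\subseteq\tilde A$ and a completely positive contraction $E\colon B\to\tilde A$ that restricts to the identity on $A$. It is a (genuine) conditional expectation if $\tilde A=A$. The local multiplier algebra $\mathcal{M}_{\mathrm{loc}}(A)$ is the $C^*$-inductive limit of the multiplier algebras $\mathcal{M}(J)$ over the essential closed two-sided ideals $J$ of $A$ (with restriction maps $\mathcal{M}(J)\hookrightarrow\mathcal{M}(I)$ for $I\subseteq J$); it contains $A$. An $\mathcal{M}_{\mathrm{loc}}$-expectation is a generalised expectation with $\tilde A=\mathcal{M}_{\mathrm{loc}}(A)$. A generalised expectation $E\colon B\to\tilde A\supseteq A$ is supportive if for any $b\in B^+$ with $E(b)\ne0$ there are $\delta>0$ and a non-zero hereditary $C^*$-subalgebra $D\subseteq A$ such that $\|xE(b)x\|\ge\delta$ for all $x\in D^+$ with $\|x\|=1$. *)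

(* Defs.v *)
From HB Require Import structures.
From mathcomp Require Import all_boot all_order all_algebra.
From mathcomp Require Import complex.
From mathcomp Require Import boolp classical_sets reals topology normedtype.

Set Implicit Arguments.
Unset Strict Implicit.
Unset Printing Implicit Defensive.

Import Order.TTheory GRing.Theory Num.Theory.
Import numFieldNormedType.Exports.

Local Open Scope classical_set_scope.
Local Open Scope ring_scope.
Local Open Scope complex_scope.

Reserved Notation "x ** y" (at level 40, left associativity).

(* C*-algebras are not assumed unital, and the zero algebra is allowed; hence
   the product is not a MathComp ring structure.  Norms take values in R[i],
   where 0 <= z means that z is a nonnegative real. *)
HB.mixin Record isCStarAlgebra (R : realType) A & CompleteNormedModule R[i] A := {
  cmul : A -> A -> A;
  star : A -> A;
  cmulA : associative cmul;
  cmulDl : left_distributive cmul +%R;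
  cmulDr : right_distributive cmul +%R;
  cmulZl : forall (k : R[i]) x y, cmul (k *: x) y = k *: cmul x y;
  cmulZr : forall (k : R[i]) x y, cmul x (k *: y) = k *: cmul x y;
  starK : involutive star;
  starD : {morph star : x y / x + y};
  starZ : forall (k : R[i]) x, star (k *: x) = conjc k *: star x;
  starM : forall x y, star (cmul x y) = cmul (star y) (star x);
  ler_normcM : forall x y, `|cmul x y| <= `|x| * `|y|;
  norm_cstar : forall x, `|cmul (star x) x| = `|x| ^+ 2
}.

#[short(type="cstarType")]
HB.structure Definition CStarAlgebra (R : realType) :=
  {A of CompleteNormedModule R[i] A & isCStarAlgebra R A}.

Notation "x ** y" := (cmul x y) : ring_scope.

Section basics.
Context {R : realType} {A : cstarType R}.
Implicit Types x y : A.

Lemma cmul0l x : 0 ** x = 0.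
Proof. by have := cmulZl 0 (0 : A) x; rewrite !scale0r. Qed.

Lemma cmul0r x : x ** 0 = 0.
Proof. by have := cmulZr 0 x (0 : A); rewrite !scale0r. Qed.

Lemma cmulNl x y : (- x) ** y = - (x ** y).
Proof. by have := cmulZl (-1) x y; rewrite !scaleN1r. Qed.

Lemma cmulNr x y : x ** (- y) = - (x ** y).
Proof. by have := cmulZr (-1) x y; rewrite !scaleN1r. Qed.

Lemma cmulBl x y z : (x - y) ** z = x ** z - y ** z.
Proof. by rewrite cmulDl cmulNl. Qed.

Lemma cmulBr x y z : z ** (x - y) = z ** x - z ** y.
Proof. by rewrite cmulDr cmulNr. Qed.

Lemma starN x : star (- x) = - star x.
Proof.
have := starZ (-1) x; rewrite !scaleN1r => ->.
by rewrite rmorphN rmorph1 scaleN1r.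
Qed.

Lemma starB x y : star (x - y) = star x - star y.
Proof. by rewrite starD starN. Qed.

Lemma star0 : star (0 : A) = 0.
Proof. by have := starB (0 : A) 0; rewrite !subrr. Qed.

Definition rnorm x : R := complex.Re `|x|.

Lemma rnormE x : `|x| = (rnorm x)%:C.
Proof.
rewrite /rnorm; have := normr_ge0 x; case: (`|x|) => a b /=.
by rewrite lecE /= => /andP[/eqP-> _].
Qed.

Lemma rnorm_ge0 x : 0 <= rnorm x.
Proof. by rewrite -lecR -rnormE normr_ge0. Qed.

Lemma rnormD x y : rnorm (x + y) <= rnorm x + rnorm y.
Proof. by rewrite -lecR rmorphD /= -!rnormE ler_normD. Qed.

Lemma rnormN x : rnorm (- x) = rnorm x.
Proof. by rewrite /rnorm normrN. Qed.

Lemma rnormB x y : rnorm (x - y) = rnorm (y - x).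
Proof. by rewrite -opprB rnormN. Qed.

Lemma rnormM x y : rnorm (x ** y) <= rnorm x * rnorm y.
Proof. by rewrite -lecR rmorphM /= -!rnormE ler_normcM. Qed.

Lemma rnormZ (k : R[i]) x : rnorm (k *: x) = complex.Re `|k| * rnorm x.
Proof.
rewrite {1}/rnorm normrZ rnormE; case: k => a b /=.
by rewrite mul0r subr0.
Qed.

Lemma rnorm0 : rnorm 0 = 0.
Proof. by rewrite /rnorm normr0. Qed.

Lemma rnorm_eq0 x : rnorm x = 0 -> x = 0.
Proof. by move=> x0; apply/eqP; rewrite -normr_eq0 rnormE x0. Qed.

Lemma rnorm_cstar x : rnorm (star x ** x) = rnorm x ^+ 2.
Proof.
by apply: complexI; rewrite rmorphXn /= -!rnormE norm_cstar.
Qed.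

Lemma rnorm_star_le x : rnorm x <= rnorm (star x).
Proof.
have := rnormM (star x) x; rewrite rnorm_cstar expr2.
have := rnorm_ge0 x; rewrite le_eqVlt => /orP[/eqP <- _|x0].
  exact: rnorm_ge0.
by rewrite ler_pM2r.
Qed.

Lemma rnorm_star x : rnorm (star x) = rnorm x.
Proof.
by apply/le_anti; rewrite rnorm_star_le andbT -{2}(starK x) rnorm_star_le.
Qed.

End basics.

Record ideal (R : realType) (A : cstarType R) := Ideal {
  ideal_set :> set A;
  ideal_closed : closed ideal_set;
  ideal0 : ideal_set 0;
  idealD : forall x y, ideal_set x -> ideal_set y -> ideal_set (x + y);
  idealZ : forall (k : R[i]) x, ideal_set x -> ideal_set (k *: x);
  idealMl : forall a x, ideal_set x -> ideal_set (a ** x);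
  idealMr : forall a x, ideal_set x -> ideal_set (x ** a)
}.

Definition ideal_full (R : realType) (A : cstarType R) : ideal A :=
  @Ideal R A setT (@closedT _) I (fun _ _ _ _ => I) (fun _ _ _ => I)
    (fun _ _ _ => I) (fun _ _ _ => I).

(* The multiplier algebra M(J), realised as the bounded adjointable operators
   on J viewed as a right Hilbert J-module with inner product
   <x, y> = x^* y.  Adjointability forces linearity, and boundedness by the
   closed graph theorem. *)
Record multiplier (R : realType) (A : cstarType R) (J : ideal A) := Multiplier {
  mapp :> J -> J;
  madj : J -> J;
  madjP : forall a b : J, star (val (mapp a)) ** val b = star (val a) ** val (madj b);
  mbounded : exists k : R, forall a : J, rnorm (val (mapp a)) <= k * rnorm (val a)
}.

Section multiplier.
Context {R : realType} {A : cstarType R} {J : ideal A}.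
Implicit Types (a b : J) (m n : multiplier J).

Lemma idealP a : ideal_set J (val a).
Proof. by have := valP a; rewrite inE. Qed.

Definition inJ (x : A) (Jx : ideal_set J x) : J := exist _ x (mem_set Jx).

Definition iadd a b : J := inJ (idealD (idealP a) (idealP b)).
Definition iscale (k : R[i]) a : J := inJ (idealZ k (idealP a)).
Definition ilmul (x : A) a : J := inJ (idealMl x (idealP a)).

Lemma idealB (x y : A) : ideal_set J x -> ideal_set J y -> ideal_set J (x - y).
Proof.
by move=> Jx Jy; rewrite -scaleN1r; apply: idealD => //; apply: idealZ.
Qed.

Lemma ideal_nondegenerate a b :
  (forall c : J, star (val a) ** val c = star (val b) ** val c) -> a = b.
Proof.
move=> ab; apply: val_inj; apply/eqP; rewrite -subr_eq0; apply/eqP.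
have Jab := idealB (idealP a) (idealP b).
apply: rnorm_eq0; apply/eqP; rewrite -sqrf_eq0 -rnorm_cstar.
by rewrite starB cmulBl (ab (inJ Jab)) subrr rnorm0.
Qed.

Lemma multiplier_ext m n : (forall a, m a = n a) -> m = n.
Proof.
case: m n => [f f' ff' bf] [g g' gg' bg] /= fg.
have {}fg : f = g by apply/funext.
subst g; have fg' : f' = g'.
  apply/funext => b; apply: ideal_nondegenerate => c.
  by apply: (inv_inj starK); rewrite !starM !starK -ff' -gg'.
by subst g'; congr Multiplier; exact: Prop_irrelevance.
Qed.

Lemma madjE m a b : star (val a) ** val (m b) = star (val (madj m a)) ** val b.
Proof. by apply: (inv_inj starK); rewrite !starM !starK madjP. Qed.

Lemma mappD m a b : val (m (iadd a b)) = val (m a) + val (m b).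
Proof.
rewrite -[RHS]/(val (iadd (m a) (m b))); congr val.
apply: ideal_nondegenerate => c.
by rewrite madjP /= !starD !cmulDl !madjP.
Qed.

Lemma mappZ m k a : val (m (iscale k a)) = k *: val (m a).
Proof.
rewrite -[RHS]/(val (iscale k (m a))); congr val.
apply: ideal_nondegenerate => c.
by rewrite madjP /= !starZ !cmulZl !madjP.
Qed.

Lemma mbounded_adj m :
  exists k : R, forall a : J, rnorm (val (madj m a)) <= k * rnorm (val a).
Proof.
have [k mk] := mbounded m; exists k => a.
set y := val (madj m a).
have : rnorm y ^+ 2 <= k * rnorm y * rnorm (val a).
  rewrite -rnorm_cstar -madjP (le_trans (rnormM _ _))// rnorm_star.
  by rewrite ler_wpM2r ?rnorm_ge0// mk.
have := rnorm_ge0 y; rewrite le_eqVlt => /orP[/eqP <- _|y0].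
  have := mk (madj m a); have := mk a.
  have [k0 _ _|k0] := leP 0 k; first by rewrite mulr_ge0 ?rnorm_ge0.
  have := rnorm_ge0 (val a); rewrite le_eqVlt => /orP[/eqP <-|a0].
    by rewrite mulr0.
  by move=> /(le_trans (rnorm_ge0 _)); rewrite pmulr_lge0// leNgt k0.
by rewrite mulrAC expr2 ler_pM2r.
Qed.

Definition mstar m : multiplier J :=
  @Multiplier R A J (madj m) (mapp m) (fun a b => esym (madjE m a b)) (mbounded_adj m).

Lemma mzero_subproof (a b : J) :
  star (val (inJ (ideal0 J))) ** val b = star (val a) ** val (inJ (ideal0 J)).
Proof. by rewrite /= star0 cmul0l cmul0r. Qed.

Lemma mzero_bounded : exists k : R, forall a : J,
  rnorm (val (inJ (ideal0 J))) <= k * rnorm (val a).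
Proof. by exists 0 => a; rewrite mul0r /= rnorm0. Qed.

Definition mzero : multiplier J :=
  @Multiplier R A J (fun=> inJ (ideal0 J)) (fun=> inJ (ideal0 J)) mzero_subproof mzero_bounded.

Lemma madd_subproof m n a b :
  star (val (iadd (m a) (n a))) ** val b =
  star (val a) ** val (iadd (madj m b) (madj n b)).
Proof. by rewrite /= starD cmulDl cmulDr !madjP. Qed.

Lemma madd_bounded m n : exists k : R, forall a : J,
  rnorm (val (iadd (m a) (n a))) <= k * rnorm (val a).
Proof.
have [k mk] := mbounded m; have [l nl] := mbounded n.
exists (k + l) => a; rewrite mulrDl (le_trans (rnormD _ _))//.
by rewrite lerD.
Qed.

Definition madd m n : multiplier J :=
  @Multiplier R A J (fun a => iadd (m a) (n a))
    (fun a => iadd (madj m a) (madj n a)) (madd_subproof m n) (madd_bounded m n).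

Lemma mscale_subproof (k : R[i]) m a b :
  star (val (iscale k (m a))) ** val b =
  star (val a) ** val (iscale (conjc k) (madj m b)).
Proof. by rewrite /= starZ cmulZl cmulZr madjP. Qed.

Lemma mscale_bounded (k : R[i]) m : exists l : R, forall a : J,
  rnorm (val (iscale k (m a))) <= l * rnorm (val a).
Proof.
have [l ml] := mbounded m; exists (complex.Re `|k| * l) => a.
have k0 : 0 <= complex.Re `|k| by have := normr_ge0 k; rewrite lecE => /andP[].
rewrite /= rnormZ -mulrA ler_wpM2l//.
exact: ml.
Qed.

Definition mscale (k : R[i]) m : multiplier J :=
  @Multiplier R A J (fun a => iscale k (m a)) (fun a => iscale (conjc k) (madj m a))
    (mscale_subproof k m) (mscale_bounded k m).

Lemma mcomp_subproof m n a b :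
  star (val (m (n a))) ** val b = star (val a) ** val (madj n (madj m b)).
Proof. by rewrite !madjP. Qed.

Lemma mcomp_bounded m n : exists l : R, forall a : J,
  rnorm (val (m (n a))) <= l * rnorm (val a).
Proof.
have [k mk] := mbounded m; have [l nl] := mbounded n.
exists (`|k| * l) => a; rewrite (le_trans (mk _))// -mulrA.
rewrite (le_trans (ler_wpM2r (rnorm_ge0 _) (ler_norm k)))//.
by rewrite ler_wpM2l.
Qed.

Definition mcomp m n : multiplier J :=
  @Multiplier R A J (fun a => m (n a)) (fun a => madj n (madj m a))
    (mcomp_subproof m n) (mcomp_bounded m n).

Lemma lmul_subproof (x : A) a b :
  star (val (ilmul x a)) ** val b = star (val a) ** val (ilmul (star x) b).
Proof. by rewrite /= starM cmulA. Qed.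

Lemma lmul_bounded (x : A) : exists l : R, forall a : J,
  rnorm (val (ilmul x a)) <= l * rnorm (val a).
Proof. by exists (rnorm x) => a; exact: rnormM. Qed.

Definition lmul (x : A) : multiplier J :=
  @Multiplier R A J (ilmul x) (ilmul (star x)) (lmul_subproof x) (lmul_bounded x).

HB.instance Definition _ := gen_eqMixin (multiplier J).
HB.instance Definition _ := gen_choiceMixin (multiplier J).

Let maddA : associative madd.
Proof. by move=> m n p; apply: multiplier_ext => a; apply/val_inj/addrA. Qed.
Let maddC : commutative madd.
Proof. by move=> m n; apply: multiplier_ext => a; apply/val_inj/addrC. Qed.
Let madd0 : left_id mzero madd.
Proof. by move=> m; apply: multiplier_ext => a; apply/val_inj/add0r. Qed.
Let maddN : left_inverse mzero (mscale (-1)) madd.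
Proof.
by move=> m; apply: multiplier_ext => a; apply/val_inj; rewrite /= scaleN1r addNr.
Qed.

HB.instance Definition _ :=
  GRing.isZmodule.Build (multiplier J) maddA maddC madd0 maddN.

Let mscaleA (k l : R[i]) m : mscale k (mscale l m) = mscale (k * l) m.
Proof. by apply: multiplier_ext => a; apply/val_inj/scalerA. Qed.
Let mscale1 : left_id 1 mscale.
Proof. by move=> m; apply: multiplier_ext => a; apply/val_inj/scale1r. Qed.
Let mscaleDr : right_distributive mscale +%R.
Proof. by move=> k m n; apply: multiplier_ext => a; apply/val_inj/scalerDr. Qed.
Let mscaleDl m : {morph mscale^~ m : k l / k + l}.
Proof. by move=> k l; apply: multiplier_ext => a; apply/val_inj/scalerDl. Qed.

HB.instance Definition _ :=
  GRing.Zmodule_isLmodule.Build R[i] (multiplier J) mscaleA mscale1 mscaleDr mscaleDl.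

Definition mnorm m : R :=
  sup [set r | exists2 a : J, rnorm (val a) <= 1 & r = rnorm (val (m a))].

Lemma mnorm_has_sup m :
  has_sup [set r | exists2 a : J, rnorm (val a) <= 1 & r = rnorm (val (m a))].
Proof.
split; first by exists (rnorm (val (m (inJ (ideal0 J))))), (inJ (ideal0 J)); rewrite //= rnorm0.
have [k mk] := mbounded m; exists `|k| => _ [a a1 ->].
rewrite (le_trans (mk a))// (le_trans (ler_wpM2r (rnorm_ge0 _) (ler_norm k)))//.
by rewrite ler_piMr.
Qed.

Lemma mnorm_lub m (k : R) : 0 <= k ->
  (forall a, rnorm (val (m a)) <= k * rnorm (val a)) -> mnorm m <= k.
Proof.
move=> k0 mk; apply: ge_sup; first by case: (mnorm_has_sup m).
by move=> _ [a a1 ->]; rewrite (le_trans (mk a))// ler_piMr.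
Qed.

Lemma mnorm_ge0 m : 0 <= mnorm m.
Proof.
apply: le_trans (sup_upper_bound (mnorm_has_sup m) _); last first.
  by exists (inJ (ideal0 J)); rewrite //= rnorm0.
exact: rnorm_ge0.
Qed.

Lemma mnorm_le m a : rnorm (val (m a)) <= mnorm m * rnorm (val a).
Proof.
have := rnorm_ge0 (val a); rewrite le_eqVlt => /orP[/eqP a0|a0].
  have [k /(_ a)] := mbounded m; rewrite -a0 !mulr0.
  exact.
have ReV : complex.Re `|((rnorm (val a))^-1)%:C| = (rnorm (val a))^-1.
  by rewrite ger0_norm ?lecR ?invr_ge0 ?rnorm_ge0.
have : rnorm (val (m (iscale (((rnorm (val a))^-1)%:C) a))) <= mnorm m.
  apply: (sup_upper_bound (mnorm_has_sup m)).
  exists (iscale (((rnorm (val a))^-1)%:C) a) => //=.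
  by rewrite rnormZ ReV mulVf ?gt_eqF.
by rewrite mappZ rnormZ ReV mulrC ler_pdivrMr.
Qed.

Let mnormD m n : (mnorm (m + n))%:C <= (mnorm m)%:C + (mnorm n)%:C.
Proof.
rewrite -rmorphD /= lecR; apply: mnorm_lub => [|a].
  by rewrite addr_ge0 ?mnorm_ge0.
by rewrite mulrDl (le_trans (rnormD _ _))// lerD// mnorm_le.
Qed.

Let mnormZ_le (k : R[i]) m : mnorm (k *: m) <= complex.Re `|k| * mnorm m.
Proof.
have k0 : 0 <= complex.Re `|k| by have := normr_ge0 k; rewrite lecE => /andP[].
apply: mnorm_lub => [|a]; first by rewrite mulr_ge0 ?mnorm_ge0.
by rewrite /= rnormZ -mulrA ler_wpM2l// mnorm_le.
Qed.

Let norm_ReE (k : R[i]) : `|k| = (complex.Re `|k|)%:C.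
Proof.
have := normr_ge0 k; case: (`|k|) => a b /=.
by rewrite lecE /= => /andP[/eqP-> _].
Qed.

Let mnormZ (k : R[i]) m : (mnorm (k *: m))%:C = `|k| * (mnorm m)%:C.
Proof.
rewrite norm_ReE -rmorphM; congr (_%:C); apply/le_anti; rewrite mnormZ_le andTb.
have [->|k0] := eqVneq k 0; first by rewrite normr0 mul0r mnorm_ge0.
have := mnormZ_le k^-1 (k *: m); rewrite scalerA mulVf// scale1r => h.
have n0 : 0 < complex.Re `|k| by rewrite -ltcR -norm_ReE normr_gt0.
rewrite -ler_pdivlMl// (le_trans h)//.
rewrite normfV norm_ReE -fmorphV/=.
exact: lexx.
Qed.

Let mnorm0_eq0 m : (mnorm m)%:C = 0 -> m = 0.
Proof.
move=> /complexI m0; apply: multiplier_ext => a; apply/val_inj.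
apply: rnorm_eq0; apply/le_anti; rewrite rnorm_ge0 andbT.
by have := mnorm_le m a; rewrite m0 mul0r.
Qed.

HB.instance Definition _ := Lmodule_isNormed.Build R[i] (multiplier J)
  mnormD mnormZ mnorm0_eq0.

Lemma multiplier_normE m : `|m| = (mnorm m)%:C.
Proof. by []. Qed.

End multiplier.

Section multiplier_cstar.
Context {R : realType} {A : cstarType R} {J : ideal A}.
Implicit Types (a b : J) (m n : multiplier J).

Lemma mnormM m n : mnorm (mcomp m n) <= mnorm m * mnorm n.
Proof.
apply: mnorm_lub => [|a]; first by rewrite mulr_ge0 ?mnorm_ge0.
by rewrite (le_trans (mnorm_le m (n a)))// -mulrA ler_wpM2l ?mnorm_ge0 ?mnorm_le.
Qed.

Lemma mnorm_sqr_le m : mnorm m ^+ 2 <= mnorm (mcomp (mstar m) m).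
Proof.
rewrite -(@ler_sqrt R) ?mnorm_ge0// sqrtr_sqr ger0_norm ?mnorm_ge0//.
apply: mnorm_lub => [|a]; first exact: sqrtr_ge0.
rewrite -(@ler_pXn2r R 2)// ?nnegrE ?mulr_ge0 ?rnorm_ge0 ?sqrtr_ge0//.
rewrite exprMn sqr_sqrtr ?mnorm_ge0// -rnorm_cstar madjP.
rewrite (le_trans (rnormM _ _))// rnorm_star mulrC expr2 mulrA.
apply: ler_wpM2r; first exact: rnorm_ge0.
exact: (mnorm_le (mcomp (mstar m) m) a).
Qed.

Lemma mnorm_mstar_le m : mnorm m <= mnorm (mstar m).
Proof.
have := le_trans (mnorm_sqr_le m) (mnormM _ _); rewrite expr2.
have := mnorm_ge0 m; rewrite le_eqVlt => /orP[/eqP <- _|m0].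
  exact: mnorm_ge0.
by rewrite ler_pM2r.
Qed.

Lemma mstarK m : mstar (mstar m) = m.
Proof. exact: multiplier_ext. Qed.

Lemma mnorm_mstar m : mnorm (mstar m) = mnorm m.
Proof.
apply/le_anti/andP; split; last exact: mnorm_mstar_le.
by have := mnorm_mstar_le (mstar m); rewrite mstarK.
Qed.

Lemma mnorm_cstar m : mnorm (mcomp (mstar m) m) = mnorm m ^+ 2.
Proof.
apply/le_anti; rewrite mnorm_sqr_le andbT expr2.
by rewrite -{1}(mnorm_mstar m) mnormM.
Qed.

End multiplier_cstar.

Section multiplier_complete.
Context {R : realType} {A : cstarType R} {J : ideal A}.
Implicit Types (a b : J) (m n : multiplier J).

Let subE m n a : val ((m - n) a) = val (m a) - val (n a).
Proof. by rewrite -[in RHS]scaleN1r. Qed.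

Let adj_subE m n a : val (madj (m - n) a) = val (madj m a) - val (madj n a).
Proof.
rewrite -[LHS]/(val (madj m a) + conjc (-1 : R[i]) *: val (madj n a)).
by rewrite rmorphN rmorph1 scaleN1r.
Qed.

Lemma multiplier_complete (F : set_system (multiplier J)) :
  ProperFilter F -> cauchy F -> cvg F.
Proof.
move=> FF /cauchyP Fc.
have cau (e : R) : 0 < e -> exists N : multiplier J, F [set n | mnorm (N - n) < e].
  move=> e0; have /Fc[N FN] : 0 < e%:C :> R[i] by rewrite ltcR.
  exists N; apply: filterS FN => n; rewrite -ball_normE /=.
  by rewrite multiplier_normE ltcR.
have lim (f : multiplier J -> J -> J) (a : J) :
    (forall m n, rnorm (val (f m a) - val (f n a)) <= mnorm (m - n) * rnorm (val a)) ->
    exists l : J, forall e : R, 0 < e -> F [set n | rnorm (val l - val (f n a)) < e].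
  move=> fle.
  have GF : ProperFilter ((fun m => val (f m a)) @ F) by exact: fmap_proper_filter.
  have /cauchy_cvg/cvg_ex[l lF] : cauchy ((fun m => val (f m a)) @ F).
    apply/cauchyP => e e0.
    have [r eE] : exists r : R, e = r%:C.
      by exists (complex.Re e); case: e e0 => x y; rewrite ltcE /= => /andP[/eqP-> _].
    subst e; rewrite ltcR in e0.
    have r0 : 0 < r / (rnorm (val a) + 1) by rewrite divr_gt0// ltr_wpDl ?rnorm_ge0.
    have [N FN] := cau _ r0; exists (val (f N a)).
    change (F ((fun m => val (f m a)) @^-1` ball (val (f N a)) r%:C)).
    apply: filterS FN => n /= Nn; rewrite -ball_normE /= rnormE ltcR.
    apply: (le_lt_trans (fle N n)).
    apply: (le_lt_trans (ler_wpM2r (rnorm_ge0 _) (ltW Nn))).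
    rewrite mulrAC ltr_pdivrMr ?ltr_wpDl ?rnorm_ge0//.
    by rewrite ltr_pM2l// ltrDl.
  have Jl : ideal_set J l.
    apply: (@closed_cvg _ _ F FF (fun m => val (f m a)) _ _ _ l lF); first exact: ideal_closed.
    by apply: filterE => n; exact: idealP.
  exists (inJ Jl) => e e0 /=.
  move/cvgrPdist_lt : lF => /(_ e%:C); rewrite ltcR => /(_ e0).
  by apply: filterS => n /=; rewrite rnormE ltcR.
have /choice[l lP] : forall a, exists l : J, forall e : R, 0 < e ->
    F [set n | rnorm (val l - val ((n : multiplier J) a)) < e].
  move=> a; apply: (lim (fun n a => n a)) => m n.
  by rewrite -subE; exact: mnorm_le.
have /choice[l' l'P] : forall a, exists l : J, forall e : R, 0 < e ->
    F [set n | rnorm (val l - val (madj n a)) < e].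
  move=> a; apply: (lim (fun n a => madj n a)) => m n.
  rewrite -(mnorm_mstar (m - n)).
  by rewrite -adj_subE; exact: (mnorm_le (mstar (m - n)) a).
have adj a b : star (val (l a)) ** val b = star (val a) ** val (l' b).
  apply/eqP; rewrite -subr_eq0; apply/eqP/rnorm_eq0/le_anti.
  rewrite rnorm_ge0 andbT; apply/ler_addgt0Pr => e e0; rewrite add0r.
  set d := e / (rnorm (val a) + rnorm (val b) + 1).
  have s0 : 0 < rnorm (val a) + rnorm (val b) + 1.
    by rewrite ltr_wpDl// addr_ge0 ?rnorm_ge0.
  have d0 : 0 < d by rewrite divr_gt0.
  have [n [/= n1 n2]] := filter_ex (filterI (lP a d d0) (l'P b d d0)).
  have -> : star (val (l a)) ** val b - star (val a) ** val (l' b) =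
     star (val (l a) - val (n a)) ** val b - star (val a) ** (val (l' b) - val (madj n b)).
    by rewrite starB cmulBl cmulBr madjP opprB addrA subrK.
  rewrite (le_trans (rnormD _ _))// rnormN.
  rewrite (le_trans (lerD (rnormM _ _) (rnormM _ _)))// !rnorm_star.
  have -> : e = d * (rnorm (val a) + rnorm (val b) + 1) by rewrite divfK ?gt_eqF.
  apply: (@le_trans _ _ (d * rnorm (val b) + rnorm (val a) * d)).
    by rewrite lerD// ?ler_wpM2r ?ler_wpM2l ?rnorm_ge0// ltW.
  by rewrite !mulrDr mulr1 [rnorm _ * d]mulrC [leLHS]addrC lerDl ltW.
have [N0 FN0] := cau 1 ltr01.
have bnd a : rnorm (val (l a)) <= (mnorm N0 + 1) * rnorm (val a).
  apply/ler_addgt0Pr => e e0.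
  have [n [/= n1 n2]] := filter_ex (filterI (lP a e e0) FN0).
  have -> : val (l a) = val (N0 a) - val ((N0 - n) a) + (val (l a) - val (n a)).
    by rewrite subE opprB [val (N0 a) + _]addrC subrK addrC subrK.
  apply: (le_trans (rnormD _ _)); apply: lerD; last exact: ltW.
  apply: (le_trans (rnormD _ _)); rewrite rnormN mulrDl.
  apply: lerD; first exact: mnorm_le.
  by apply: (le_trans (mnorm_le _ _)); rewrite ler_wpM2r ?rnorm_ge0 ?ltW.
pose m := @Multiplier R A J l l' adj (ex_intro _ _ bnd).
apply/cvg_ex; exists m; apply/cvgrPdist_lt => e e0.
have [r eE] : exists r : R, e = r%:C.
  by exists (complex.Re e); case: e e0 => x y; rewrite ltcE /= => /andP[/eqP-> _].
subst e; rewrite ltcR in e0.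
have r0 : 0 < r / 3%:R by rewrite divr_gt0.
have [N FN] := cau _ r0; have FN' := FN; apply: filterS FN' => n /= Nn.
rewrite multiplier_normE ltcR.
apply: (@le_lt_trans _ _ (r / 3%:R + r / 3%:R)); last first.
  by rewrite -mulrDl ltr_pdivrMr// -mulr2n -[ltLHS]mulr_natr ltr_pM2l// ltr_nat.
apply: mnorm_lub => [|a]; first by rewrite addr_ge0 ?ltW.
apply/ler_addgt0Pr => d d0.
have [p [/= p1 p2]] := filter_ex (filterI (lP a d d0) FN).
rewrite -[X in X <= _]/(rnorm (val ((m - n) a))).
have -> : val ((m - n) a) = val ((N - n) a) - val ((N - p) a) + (val (l a) - val (p a)).
  have tri (x y z w : A) : x - y = (w - y) - (w - z) + (x - z).
    by rewrite opprB [w - y + _]addrC [z - w + _]addrA subrK [RHS]addrC [RHS]addrA subrK.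
  by rewrite !subE; exact: tri.
apply: (le_trans (rnormD _ _)); apply: lerD; last exact: ltW.
apply: (le_trans (rnormD _ _)); rewrite rnormN mulrDl; apply: lerD.
  by apply: (le_trans (mnorm_le _ _)); rewrite ler_wpM2r ?rnorm_ge0 ?ltW.
by apply: (le_trans (mnorm_le _ _)); rewrite ler_wpM2r ?rnorm_ge0 ?ltW.
Qed.

HB.instance Definition _ :=
  Uniform_isComplete.Build (multiplier J) multiplier_complete.

End multiplier_complete.

Section multiplier_cstarType.
Context {R : realType} {A : cstarType R} {J : ideal A}.
Implicit Types (m n p : multiplier J).

Let mcompA : associative (@mcomp R A J).
Proof. by move=> m n p; exact: multiplier_ext. Qed.
Let mcompDl : left_distributive (@mcomp R A J) +%R.
Proof. by move=> m n p; exact: multiplier_ext. Qed.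
Let mcompDr : right_distributive (@mcomp R A J) +%R.
Proof. by move=> m n p; apply: multiplier_ext => a; apply/val_inj/mappD. Qed.
Let mcompZl (k : R[i]) m n : mcomp (k *: m) n = k *: mcomp m n.
Proof. exact: multiplier_ext. Qed.
Let mcompZr (k : R[i]) m n : mcomp m (k *: n) = k *: mcomp m n.
Proof. by apply: multiplier_ext => a; apply/val_inj/mappZ. Qed.
Let mstarD : {morph (@mstar R A J) : m n / m + n}.
Proof. by move=> m n; exact: multiplier_ext. Qed.
Let mstarZ (k : R[i]) m : mstar (k *: m) = conjc k *: mstar m.
Proof. exact: multiplier_ext. Qed.
Let mstarM m n : mstar (mcomp m n) = mcomp (mstar n) (mstar m).
Proof. exact: multiplier_ext. Qed.
Let normM m n : `|mcomp m n| <= `|m| * `|n|.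
Proof. by rewrite !multiplier_normE -rmorphM lecR mnormM. Qed.
Let norm_cs m : `|mcomp (mstar m) m| = `|m| ^+ 2.
Proof. by rewrite !multiplier_normE -rmorphXn mnorm_cstar. Qed.

HB.instance Definition _ := isCStarAlgebra.Build R (multiplier J)
  mcompA mcompDl mcompDr mcompZl mcompZr mstarK mstarD mstarZ mstarM
  normM norm_cs.

End multiplier_cstarType.

Record cstar_inclusion (R : realType) (A B : cstarType R) := CStarInclusion {
  incl :> A -> B;
  incl_linear : linear incl;
  incl_mul : {morph incl : x y / x ** y};
  incl_star : {morph incl : x / star x};
  incl_norm : forall x, `|incl x| = `|x|
}.

Definition id_inclusion (R : realType) (A : cstarType R) : cstar_inclusion A A :=
  @CStarInclusion R A A id (fun _ _ _ => erefl) (fun _ _ => erefl)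
    (fun _ => erefl) (fun _ => erefl).

Section comp_inclusion.
Context {R : realType} {A B C : cstarType R}.
Variables (i : cstar_inclusion A B) (j : cstar_inclusion B C).

Let f : A -> C := j \o i.
Let f_linear : linear f.
Proof. by move=> k x y; rewrite /f /= incl_linear incl_linear. Qed.
Let f_mul : {morph f : x y / x ** y}.
Proof. by move=> x y; rewrite /f /= !incl_mul. Qed.
Let f_star : {morph f : x / star x}.
Proof. by move=> x; rewrite /f /= !incl_star. Qed.
Let f_norm x : `|f x| = `|x|.
Proof. by rewrite /f /= !incl_norm. Qed.

Definition comp_inclusion := CStarInclusion f_linear f_mul f_star f_norm.

End comp_inclusion.

Section lmul_inclusion.
Context {R : realType} {A : cstarType R}.

Let f : A -> multiplier (ideal_full A) := lmul.
Let f_linear : linear f.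
Proof.
move=> k x y; apply: multiplier_ext => a; apply/val_inj.
by rewrite /= cmulDl cmulZl.
Qed.
Let f_mul : {morph f : x y / x ** y}.
Proof.
by move=> x y; apply: multiplier_ext => a; apply/val_inj; rewrite /= -cmulA.
Qed.
Let f_star : {morph f : x / star x}.
Proof. by move=> x; exact: multiplier_ext. Qed.
Let f_norm x : `|f x| = `|x|.
Proof.
rewrite multiplier_normE rnormE; congr _%:C; apply/le_anti/andP; split.
  by apply: mnorm_lub => [|a]; [exact: rnorm_ge0|exact: rnormM].
have [x0|/eqP x0] := eqVneq (rnorm x) 0; first by rewrite x0 mnorm_ge0.
have {}x0 : 0 < rnorm x by rewrite lt_neqAle rnorm_ge0 eq_sym andbT; apply/eqP.
rewrite -(ler_pM2r x0) -expr2 -{1}(rnorm_star x) -rnorm_cstar starK.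
rewrite -(rnorm_star x).
exact: (mnorm_le (f x) (inJ (J := ideal_full A) (x := star x) I)).
Qed.

Definition lmul_inclusion : cstar_inclusion A (multiplier (ideal_full A)) :=
  CStarInclusion f_linear f_mul f_star f_norm.

End lmul_inclusion.

Definition essential (R : realType) (A : cstarType R) (J : ideal A) : Prop :=
  forall K : ideal A, (exists2 x, ideal_set K x & x != 0) ->
    exists x, [/\ ideal_set J x, ideal_set K x & x != 0].

Lemma essential_full (R : realType) (A : cstarType R) : essential (ideal_full A).
Proof. by move=> K [x Kx x0]; exists x. Qed.

(* The graph of the restriction map M(J) -> M(K), for K contained in J.  That a
   multiplier of J maps K into K is a theorem, so the map is used through its
   graph. *)
Definition restricts_to (R : realType) (A : cstarType R) (J K : ideal A)
    (m : multiplier J) (n : multiplier K) : Prop :=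
  forall (a : J) (b : K), val a = val b -> val (m a) = val (n b).

(* A C*-inductive limit of the algebras M(J), J essential: as the connecting
   maps are isometric inclusions, this is a completion of their union.  The
   limit is determined by these data up to unique isomorphism.  Its copy of A
   is the one inside M(A), given by left multiplication. *)
Record local_multiplier_algebra (R : realType) (A : cstarType R) :=
  LocalMultiplierAlgebra {
  mloc :> cstarType R;
  mloc_in : forall J : ideal A, essential J -> cstar_inclusion (multiplier J) mloc;
  mloc_compat : forall (J K : ideal A) (eJ : essential J) (eK : essential K),
    ideal_set K `<=` ideal_set J ->
    forall (m : multiplier J) (n : multiplier K), restricts_to m n ->
      mloc_in eJ m = mloc_in eK n;
  mloc_dense : closure [set x | exists (J : ideal A) (eJ : essential J)
                                  (m : multiplier J), x = mloc_in eJ m] = setT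
}.

Definition mloc_inclusion (R : realType) (A : cstarType R)
    (M : local_multiplier_algebra A) : cstar_inclusion A M :=
  comp_inclusion lmul_inclusion (mloc_in M (@essential_full R A)).

Lemma mloc_inclusionE (R : realType) (A : cstarType R)
    (M : local_multiplier_algebra A) (J : ideal A) (eJ : essential J) (a : A) :
  mloc_inclusion M a = mloc_in M eJ (lmul a).
Proof. by apply: mloc_compat => // x y /= ->. Qed.

(* For x in a C*-subalgebra D, positivity in D and in A agree. *)
Definition positive_elt (R : realType) (A : cstarType R) (x : A) : Prop :=
  exists y, x = star y ** y.

(* Positivity in the C*-algebra M_n(A), with its usual product and involution. *)
Definition mx_positive (R : realType) (A : cstarType R) n (X : 'M[A]_n) : Prop :=
  exists Y : 'M[A]_n, X = \matrix_(i, j) \sum_k star (Y k i) ** Y k j.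

Record completely_positive (R : realType) (A B : cstarType R) (E : A -> B) : Prop := {
  cp_linear : linear E;
  cp_positive : forall n (X : 'M[A]_n), mx_positive X -> mx_positive (map_mx E X)
}.

Record generalised_expectation (R : realType) (A B C : cstarType R)
    (i : cstar_inclusion A B) (j : cstar_inclusion A C) (E : B -> C) : Prop := {
  gexp_cp : completely_positive E;
  gexp_contraction : forall b, `|E b| <= `|b|;
  gexp_id : forall a, E (i a) = j a
}.

Definition conditional_expectation (R : realType) (A B : cstarType R)
    (i : cstar_inclusion A B) (E : B -> A) : Prop :=
  generalised_expectation i (id_inclusion A) E.

Definition mloc_expectation (R : realType) (A B : cstarType R)
    (i : cstar_inclusion A B) (M : local_multiplier_algebra A) (E : B -> M) : Prop :=
  generalised_expectation i (mloc_inclusion M) E.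

Record hereditary_subalgebra (R : realType) (A : cstarType R) (D : set A) : Prop := {
  her_closed : closed D;
  her0 : D 0;
  herD : forall x y, D x -> D y -> D (x + y);
  herZ : forall (k : R[i]) x, D x -> D (k *: x);
  herM : forall x y, D x -> D y -> D (x ** y);
  her_star : forall x, D x -> D (star x);
  her_le : forall a d, D d -> positive_elt a -> positive_elt (d - a) -> D a
}.

Definition supportive (R : realType) (A B C : cstarType R)
    (j : cstar_inclusion A C) (E : B -> C) : Prop :=
  forall b : B, positive_elt b -> E b != 0 ->
    exists (delta : R) (D : set A),
      [/\ 0 < delta, hereditary_subalgebra D, (exists2 d, D d & d != 0) &
          forall x, D x -> positive_elt x -> `|x| = 1 ->
            delta%:C <= `|j x ** E b ** j x|].

(* Main.v *)
From HB Require Import structures.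
Require Import Defs.
From mathcomp Require Import all_boot all_order all_algebra.
From mathcomp Require Import complex.
From mathcomp Require Import boolp classical_sets reals topology normedtype.
From mathcomp Require Import ring lra.

(** Why the theorem holds.  Put e = E b.  Complete positivity gives
    e = y^* y, and approximating y by some n in M(J), J essential, makes e
    close to the positive multiplier m = n^* n.  Fix 0 <= lambda < ||m||.  The
    elements of A living in the spectral part of m above lambda form a
    hereditary subalgebra D on which m >= lambda, so for positive x in D of
    norm 1 we get ||x m x|| >= lambda ||x^2|| = lambda; replacing m by e costs
    no more than ||e - m||.  A conditional expectation is the same argument
    inside M(A), without approximation.

    The spectral part needs no functional calculus.  With k = m - lambda and
    g = |k| - k, a multiple of the negative part of k, D is taken to be the set
    of those x in A with g x = x g = 0, computed in M(J).  It is hereditary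
    because 0 <= a <= d and g d g = 0 force g a g = 0 ([gram_sum_eq0]); it is
    nonzero because g is annihilated by |k| + k, which would vanish only if m
    were bounded by lambda; and on D one has k x = |k| x, whence
    x m x - lambda x^2 = x |k| x >= 0.  Cutting D out of A rather than out of J
    leaves a single requirement on J, that A act on it isometrically.

    What remains is the order theory of a unital C*-algebra, built from one
    analytic fact: 1 - x has a self-adjoint square root when x is self-adjoint
    and ||x|| <= 1 ([sqrt_one_sub]).  Positive means being the square of a
    self-adjoint element.  If c, d are commuting self-adjoint elements with
    c^2 + d^2 = t, then d + ic has norm at most sqrt t, so ||d||^2 <= t
    ([rnorm_summand_sqr]); together with square roots this yields the test
    ||t - x|| <= t for positivity, hence that positive elements form a cone on
    which the norm is monotone.  Finally y^* y is positive ([pos_gram]). *)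

Set Implicit Arguments.
Unset Strict Implicit.
Unset Printing Implicit Defensive.

Import Order.TTheory GRing.Theory Num.Theory.
Import numFieldNormedType.Exports.

Local Open Scope classical_set_scope.
Local Open Scope ring_scope.
Local Open Scope complex_scope.

(** * The multiplier algebra as a unital ring *)

(** The ring structure makes the theory of commuting elements available; the
    product is convertible to [cmul].  Working in M(J) rather than in A also
    provides the unit on which the order theory below relies. *)
Section multiplier_unital.
Context {R : realType} {A : cstarType R} {J : ideal A}.

Lemma mone_subproof (a b : J) : star (val a) ** val b = star (val a) ** val b.
Proof. by []. Qed.

Lemma mone_bounded : exists k : R, forall a : J, rnorm (val a) <= k * rnorm (val a).
Proof. by exists 1 => a; rewrite mul1r. Qed.

Definition mone : multiplier J :=
  @Multiplier R A J id id mone_subproof mone_bounded.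

Let mone_mul : left_id mone cmul.
Proof. by move=> m; exact: multiplier_ext. Qed.
Let mmul_one : right_id mone cmul.
Proof. by move=> m; exact: multiplier_ext. Qed.

HB.instance Definition _ := GRing.Zmodule_isPzRing.Build (multiplier J)
  cmulA mone_mul mmul_one cmulDl cmulDr.

Implicit Types x y : multiplier J.

Lemma mulE x y : x ** y = x * y. Proof. by []. Qed.

Lemma scaleMl (k : R[i]) x y : k *: x * y = k *: (x * y).
Proof. exact: cmulZl. Qed.

Lemma scaleMr (k : R[i]) x y : x * (k *: y) = k *: (x * y).
Proof. exact: cmulZr. Qed.

Lemma starMr x y : star (x * y) = star y * star x.
Proof. exact: starM. Qed.

Lemma star1 : star (1 : multiplier J) = 1.
Proof. exact: multiplier_ext. Qed.

Lemma rnormMr x y : rnorm (x * y) <= rnorm x * rnorm y.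
Proof. exact: rnormM. Qed.

Lemma rnorm_cstar_r x : rnorm (star x * x) = rnorm x ^+ 2.
Proof. exact: rnorm_cstar. Qed.

(** Only an inequality: the zero algebra is allowed. *)
Lemma rnorm1 : rnorm (1 : multiplier J) <= 1.
Proof.
have := rnorm_cstar_r 1; rewrite star1 mulr1 => h.
rewrite leNgt; apply/negP => h1.
have : rnorm (1 : multiplier J) < rnorm (1 : multiplier J) ^+ 2.
  by rewrite expr2 ltr_pMr // (lt_trans ltr01 h1).
by rewrite -h ltxx.
Qed.

Lemma commZ (k : R[i]) x y : GRing.comm x y -> GRing.comm x (k *: y).
Proof. by rewrite /GRing.comm scaleMl scaleMr => ->. Qed.

End multiplier_unital.

(** * Limits and closedness in the real-valued norm *)

Section rnorm_theory.
Context {R : realType} {A : cstarType R}.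
Implicit Types (x y : A) (t : R).

Lemma rnormZr t x : 0 <= t -> rnorm (t%:C *: x) = t * rnorm x.
Proof. by move=> t0; rewrite rnormZ ger0_norm ?lecR. Qed.

Lemma rnorm_gt0 x : x != 0 -> 0 < rnorm x.
Proof.
move=> x0; rewrite lt_neqAle rnorm_ge0 andbT eq_sym.
by apply: contra x0 => /eqP /rnorm_eq0 ->.
Qed.

Lemma rnorm_small_eq0 x : (forall e, 0 < e -> rnorm x <= e) -> x = 0.
Proof.
move=> h; apply: rnorm_eq0; apply/le_anti; rewrite rnorm_ge0 andbT.
by apply/ler_addgt0Pr => e e0; rewrite add0r h.
Qed.

Lemma nondecreasing_ubound_osc (b : nat -> R) (M : R) :
  (forall n, b n <= b n.+1) -> (forall n, b n <= M) ->
  forall e, 0 < e -> exists N, forall n, (N <= n)%N -> b n - b N < e.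
Proof.
move=> bS bM e e0.
have bm n k : b n <= b (n + k)%N.
  by elim: k => [|k IH]; rewrite ?addn0// addnS (le_trans IH).
have hs : has_sup (range b) by split; [exists (b 0%N), 0%N|exists M => _ [n _ <-]].
have [_ [N _ <-] hN] := sup_adherent e0 hs.
exists N => n _.
have := sup_upper_bound hs (ex_intro2 _ _ n I erefl); lra.
Qed.

(** A majorised sequence: steps bounded by those of a bounded real sequence
    make it Cauchy, with no estimate on the rate. *)
Lemma summable_steps_cvg (a : nat -> A) (b : nat -> R) (M : R) :
  (forall n, rnorm (a n.+1 - a n) <= b n.+1 - b n) -> (forall n, b n <= M) ->
  exists l, forall e, 0 < e -> exists N, forall n, (N <= n)%N -> rnorm (l - a n) < e.
Proof.
move=> ab bM.
have bS n : b n <= b n.+1 by rewrite -subr_ge0 (le_trans _ (ab n)) ?rnorm_ge0.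
have abk n k : rnorm (a (n + k)%N - a n) <= b (n + k)%N - b n.
  elim: k => [|k IH]; first by rewrite addn0 !subrr rnorm0.
  rewrite addnS.
  have := rnormD (a (n + k).+1 - a (n + k)%N) (a (n + k)%N - a n).
  by rewrite addrA subrK; have := ab (n + k)%N; lra.
have GF : ProperFilter (a @ \oo) by exact: fmap_proper_filter.
have /cauchy_cvg/cvg_ex[l lF] : cauchy (a @ \oo).
  apply/cauchyP => e e0.
  have [r eE] : exists r : R, e = r%:C.
    by exists (complex.Re e); case: e e0 => x y; rewrite ltcE /= => /andP[/eqP-> _].
  subst e; rewrite ltcR in e0.
  have [N hN] := nondecreasing_ubound_osc bS bM e0.
  exists (a N); exists N => // n /= Nn; rewrite -ball_normE /= rnormE ltcR.
  by rewrite rnormB -(subnKC Nn) (le_lt_trans (abk _ _))// subnKC// hN.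
exists l => e e0; move/cvgrPdist_lt : lF => /(_ e%:C); rewrite ltcR => /(_ e0).
by case=> N _ hN; exists N => n /hN /=; rewrite rnormE ltcR.
Qed.

End rnorm_theory.

(** Carries the linear properties of approximants, such as being self-adjoint or
    commuting with a given element, over to the limit. *)
Lemma bounded_ker_limit (R : realType) (A C : cstarType R)
    (f : A -> C) (k : R) (l : A) :
  {morph f : u v / u - v} -> (forall u, rnorm (f u) <= k * rnorm u) ->
  (forall e, 0 < e -> exists2 a, f a = 0 & rnorm (l - a) < e) -> f l = 0.
Proof.
move=> fB fk h; apply: rnorm_small_eq0 => e e0.
have k0 : 0 < `|k| + 1 by rewrite ltr_wpDl.
have [a fa la] := h (e / (`|k| + 1)) (divr_gt0 e0 k0).
have -> : f l = f (l - a) by rewrite fB fa subr0.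
rewrite (le_trans (fk _))//.
apply: (@le_trans _ _ ((`|k| + 1) * rnorm (l - a))).
  by rewrite ler_wpM2r ?rnorm_ge0// (le_trans (ler_norm k))// lerDl.
by rewrite mulrC -ler_pdivlMr// ltW.
Qed.

Lemma closed_ker (R : realType) (A C : cstarType R) (f : A -> C) (k : R) :
  {morph f : u v / u - v} -> (forall u, rnorm (f u) <= k * rnorm u) ->
  closed [set x | f x = 0].
Proof.
move=> fB fk l cl; apply: (@bounded_ker_limit _ _ _ f k) => // e e0.
have [|a [/= fa]] := cl (ball l e%:C); first by apply: nbhsx_ballx; rewrite ltcR.
by rewrite -ball_normE /= rnormE ltcR; exists a.
Qed.

(** * Square roots *)

Section square_root.
Context {R : realType} {A : cstarType R} {J : ideal A}.
Notation U := (multiplier J).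

Section iteration.
Variable x : U.
Hypotheses (x1 : rnorm x <= 1) (xsa : star x = x).

(* A fixed point l of [step] satisfies 2 l = x + l^2, that is
   (1 - l)^2 = 1 - x; [stepR] is the same map for x = 1 in the reals, and its
   iterates majorise those of [step]. *)
Let step (b : U) : U := (2^-1)%:C *: (x + b * b).
Let b n : U := iter n step 0.
Let stepR (t : R) : R := (1 + t * t) / 2.
Let beta n : R := iter n stepR 0.

Let beta01 n : 0 <= beta n <= 1.
Proof.
elim: n => [|n /andP[h0 h1]]; first by rewrite lexx ler01.
by rewrite /beta iterS -/(beta n) /stepR; apply/andP; split; nra.
Qed.

Let b_norm n : rnorm (b n) <= beta n.
Proof.
elim: n => [|n IH]; first by rewrite rnorm0.
rewrite /b /beta !iterS -/(beta n) -/(b n) /step /stepR rnormZr ?invr_ge0//.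
rewrite mulrC ler_wpM2r ?invr_ge0// (le_trans (rnormD _ _))// lerD//.
by rewrite (le_trans (rnormMr _ _))// ler_pM ?rnorm_ge0.
Qed.

Let b_comm y n : GRing.comm y x -> GRing.comm y (b n).
Proof.
move=> yx; elim: n => [|n IH]; first exact: commr0.
by rewrite /b iterS -/(b n); apply/commZ/commrD => //; exact: commrM.
Qed.

Let b_sa n : star (b n) = b n.
Proof.
elim: n => [|n IH]; first exact: star0.
by rewrite /b iterS -/(b n) /step starZ starD xsa starMr IH conjc_real.
Qed.

Let sub_sqr (u v : U) : GRing.comm u v -> u * u - v * v = (u + v) * (u - v).
Proof. by move=> c; rewrite mulrDl !mulrBr c addrA subrK. Qed.

Let b_step n : rnorm (b n.+1 - b n) <= beta n.+1 - beta n.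
Proof.
elim: n => [|n IH].
  rewrite /b /beta /= subr0 subr0 /step /stepR !mulr0 !addr0 rnormZr ?invr_ge0//.
  by rewrite mul1r ler_piMr ?invr_ge0.
have -> : b n.+2 - b n.+1 = (2^-1)%:C *: ((b n.+1 + b n) * (b n.+1 - b n)).
  rewrite -sub_sqr; last by apply/b_comm/commr_sym/b_comm.
  rewrite (_ : b n.+2 - b n.+1 = step (b n.+1) - step (b n))// -scalerBr.
  congr (_ *: _).
  by rewrite opprD addrACA subrr add0r.
rewrite rnormZr ?invr_ge0//.
have -> : beta n.+2 - beta n.+1 = 2^-1 * ((beta n.+1 + beta n) * (beta n.+1 - beta n)).
  rewrite (_ : beta n.+2 - beta n.+1 = stepR (beta n.+1) - stepR (beta n))//.
  by rewrite /stepR; lra.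
rewrite ler_wpM2l ?invr_ge0//.
rewrite (le_trans (rnormMr _ _))// ler_pM ?rnorm_ge0//.
by rewrite (le_trans (rnormD _ _))// lerD.
Qed.

(** The bound ||x|| <= 1 includes equality, where the binomial series of the
    square root is not geometric: convergence comes from majorising by the
    bounded increasing real iteration with x = 1.  The root is 1 - l; bounding l
    by 1 is what later makes the root itself positive, and commuting with
    whatever commutes with x replaces membership in the algebra generated
    by x. *)
Lemma sqrt_one_sub : exists l : U, [/\ star l = l, rnorm l <= 1,
  (1 - l) * (1 - l) = 1 - x & forall y, GRing.comm y x -> GRing.comm y l].
Proof.
have beta1 n : beta n <= 1 by case/andP: (beta01 n).
have [l hl] := summable_steps_cvg b_step beta1.
have near e : 0 < e -> exists n, rnorm (l - b n) < e /\ rnorm (l - b n.+1) < e.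
  by move=> /hl[N hN]; exists N; rewrite !hN.
have l1 : rnorm l <= 1.
  apply/ler_addgt0Pr => e /near[n [h _]].
  have := rnormD (b n) (l - b n); rewrite addrC subrK.
  by have := b_norm n; have := beta1 n; lra.
exists l; split => //.
- apply/eqP; rewrite -subr_eq0; apply/eqP.
  apply: (@bounded_ker_limit _ _ _ (fun u : U => star u - u) 2).
  + by move=> u v; rewrite starB opprD addrACA opprD.
  + move=> u; have := rnormD (star u) (- u); rewrite rnormN rnorm_star; lra.
  + by move=> e /near[n [h _]]; exists (b n) => //; rewrite b_sa subrr.
- suff lE : l + l = x + l * l.
    rewrite mulrBl mul1r mulrBr mulr1 opprB addrA.
    have -> : 1 - l + l * l - l = 1 - (l + l) + l * l.
      by rewrite opprD addrA addrAC.
    by rewrite lE opprD addrA subrK.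
  suff lE : step l - l = 0.
    have -> : x + l * l = 2%:C *: step l.
      by rewrite /step scalerA -rmorphM divff ?pnatr_eq0// scale1r.
    have -> : step l = l by apply/eqP; rewrite -subr_eq0 lE.
    by rewrite -[in LHS](scale1r l) -scalerDl -(rmorphD (real_complex R)).
  apply: rnorm_small_eq0 => e e0.
  have /near[n [h1 h2]] : 0 < e / 2 by rewrite divr_gt0.
  have -> : step l - l = (2^-1)%:C *: (l * (l - b n) + (l - b n) * b n) - (l - b n.+1).
    have -> : l * (l - b n) + (l - b n) * b n = x + l * l - (x + b n * b n).
      by rewrite mulrBr mulrBl addrA subrK opprD addrACA subrr add0r.
    by rewrite scalerBr -/(step l) -/(step (b n)) opprB addrA subrK.
  have := rnormD ((2^-1)%:C *: (l * (l - b n) + (l - b n) * b n)) (- (l - b n.+1)).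
  rewrite rnormN rnormZr ?invr_ge0//.
  have := rnormD (l * (l - b n)) ((l - b n) * b n).
  have := rnormMr l (l - b n); have := rnormMr (l - b n) (b n).
  have := b_norm n; have := beta1 n; have := rnorm_ge0 (l - b n).
  have := rnorm_ge0 l; have := rnorm_ge0 (b n); nra.
- move=> y yx; apply/eqP; rewrite -subr_eq0; apply/eqP.
  apply: (@bounded_ker_limit _ _ _ (fun u : U => y * u - u * y) (2 * rnorm y)).
  + by move=> u v; rewrite mulrBr mulrBl !opprD addrACA.
  + move=> u; have := rnormD (y * u) (- (u * y)); rewrite rnormN.
    by have := rnormMr y u; have := rnormMr u y; lra.
  + by move=> e /near[n [h _]]; exists (b n) => //; rewrite (b_comm n yx) subrr.
Qed.

End iteration.

End square_root.

(** * Positivity *)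

Lemma imaginary_unit (R : realType) : exists2 k : R[i], conjc k = - k & k * k = -1.
Proof.
exists (Complex 0 1); apply/eqP; rewrite eq_complex /=.
  by rewrite oppr0 !eqxx.
by rewrite !mul0r mulr0 addr0 mulr1 sub0r oppr0 !eqxx.
Qed.

Section order.
Context {R : realType} {A : cstarType R} {J : ideal A}.
Notation U := (multiplier J).
Implicit Types (x y : U) (t : R).

(** Squares rather than elements y^* y: order theory is developed first, and
    is then used to prove that the latter are positive too. *)
Definition pos x := exists2 s : U, star s = s & x = s * s.

Lemma pos_sa x : pos x -> star x = x.
Proof. by case=> s sa ->; rewrite starMr sa. Qed.

Lemma star_realZ t x : star (t%:C *: x) = t%:C *: star x.
Proof. by rewrite starZ conjc_real. Qed.

Lemma star_scalar t : star (t%:C *: (1 : U)) = t%:C *: (1 : U).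
Proof. by rewrite star_realZ star1. Qed.

Lemma comm_scalar y (k : R[i]) : GRing.comm y (k *: (1 : U)).
Proof. exact/commZ/commr1. Qed.

Lemma rnorm_sa_sqr x : star x = x -> rnorm (x * x) = rnorm x ^+ 2.
Proof. by move=> sx; rewrite -rnorm_cstar_r sx. Qed.

(** As c and d commute, w = d + ic is normal with w^* w = c^2 + d^2, so
    ||w||^2 <= t by the C*-identity, and d is the real part of w. *)
Lemma rnorm_summand_sqr (c d : U) t : 0 <= t ->
  star c = c -> star d = d -> GRing.comm c d ->
  c * c + d * d = t%:C *: (1 : U) -> rnorm d ^+ 2 <= t.
Proof.
move=> t0 sc sd cd E.
have [k conjk kk] := imaginary_unit R.
pose w : U := d + k *: c.
have sw : star w = d - k *: c by rewrite /w starD starZ sc sd conjk scaleNr.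
have ww : star w * w = t%:C *: (1 : U).
  rewrite sw /w mulrBl !mulrDr !scaleMl !scaleMr cd scalerA kk scaleN1r.
  by rewrite opprD opprK addrA addrK addrC.
have nw : rnorm w ^+ 2 <= t.
  by rewrite -rnorm_cstar_r ww rnormZr// ler_piMr//; exact: rnorm1.
have nd : rnorm d <= rnorm w.
  have -> : d = (2^-1)%:C *: (w + star w).
    rewrite sw /w addrACA subrr addr0 scalerDr -scalerDl -(rmorphD (real_complex R)).
    by rewrite -[in LHS](scale1r d); congr (_%:C *: _); lra.
  rewrite rnormZr ?invr_ge0//.
  by have := rnormD w (star w); rewrite rnorm_star; lra.
by rewrite (le_trans _ nw)// lerXn2r ?nnegrE ?rnorm_ge0.
Qed.

(** As 1 - x^2 has a root r commuting with x, [rnorm_summand_sqr] applies to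
    x^2 + r^2 = 1. *)
Lemma rnorm_one_sub_sqr x : star x = x -> rnorm x <= 1 -> rnorm (1 - x * x) <= 1.
Proof.
move=> sx x1.
have xx1 : rnorm (x * x) <= 1.
  by rewrite (le_trans (rnormMr _ _))// mulr_ile1 ?rnorm_ge0.
have sxx : star (x * x) = x * x by rewrite starMr sx.
have [l [sl _ lE lc]] := sqrt_one_sub xx1 sxx.
have s1l : star (1 - l) = 1 - l by rewrite starB sl star1.
rewrite -lE rnorm_sa_sqr//; apply: (@rnorm_summand_sqr x (1 - l)) => //.
  by apply: commrB; [exact: commr1|apply/lc/commrM].
by rewrite lE addrC subrK scale1r.
Qed.

(** Apply [sqrt_one_sub] to 1 - x / t.  The estimate on the root s says that s
    passes the same test with sqrt t, hence is positive in its turn. *)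
Lemma pos_root_of_dist x t : star x = x -> 0 <= t ->
  rnorm (t%:C *: (1 : U) - x) <= t ->
  exists s : U, [/\ star s = s, s * s = x,
    rnorm ((Num.sqrt t)%:C *: (1 : U) - s) <= Num.sqrt t
    & forall y, GRing.comm y x -> GRing.comm y s].
Proof.
move=> sx; rewrite le_eqVlt => /orP[/eqP<-|t0 tx].
  rewrite scale0r sub0r rnormN => x0.
  have {}x0 : x = 0 by apply: rnorm_eq0; apply/le_anti; rewrite x0 rnorm_ge0.
  by exists 0; rewrite star0 mulr0 x0 sqrtr0 scale0r subr0 rnorm0; split.
pose z := 1 - t^-1%:C *: x.
have zE : z = t^-1%:C *: (t%:C *: (1 : U) - x).
  by rewrite scalerBr scalerA -(rmorphM (real_complex R)) mulVf ?gt_eqF// scale1r.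
have z1 : rnorm z <= 1.
  by rewrite zE rnormZr ?invr_ge0 ?(ltW t0)// mulrC ler_pdivrMr// mul1r.
have sz : star z = z by rewrite /z starB star1 star_realZ sx.
have [l [sl l1 lE lc]] := sqrt_one_sub z1 sz.
exists ((Num.sqrt t)%:C *: (1 - l)); split.
- by rewrite star_realZ starB star1 sl.
- rewrite scaleMl scaleMr lE /z opprB addrC subrK !scalerA -!(rmorphM (real_complex R)).
  by rewrite -expr2 sqr_sqrtr ?(ltW t0)// divff ?gt_eqF// scale1r.
- by rewrite -scalerBr opprB addrC subrK rnormZr ?sqrtr_ge0// ler_piMr ?sqrtr_ge0.
- move=> y yx; apply/commZ/commrB; first exact: commr1.
  by apply/lc/commrB; [exact: commr1|exact: commZ].
Qed.

Lemma pos_dist x t : pos x -> rnorm x <= t -> rnorm (t%:C *: (1 : U) - x) <= t.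
Proof.
case=> s ss ->; rewrite rnorm_sa_sqr// => st.
have t0 : 0 <= t by rewrite (le_trans _ st)// sqr_ge0.
move: t0; rewrite le_eqVlt => /orP[/eqP t0|t0].
  have s0 : s = 0.
    apply: rnorm_eq0; apply/eqP; rewrite -sqrf_eq0; apply/eqP/le_anti.
    by rewrite sqr_ge0 andbT t0.
  by rewrite -t0 s0 scale0r mulr0 subr0 rnorm0.
pose r := Num.sqrt t; have r0 : 0 < r by rewrite sqrtr_gt0.
have rr : t = r * r by rewrite -expr2 sqr_sqrtr// ltW.
pose y := r^-1%:C *: s.
have y1 : rnorm y <= 1.
  rewrite rnormZr ?invr_ge0 ?(ltW r0)// mulrC ler_pdivrMr// mul1r.
  by rewrite -(ler_pXn2r (n:=2)) ?nnegrE ?rnorm_ge0 ?(ltW r0)// [r ^+ 2]expr2 -rr.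
have sy : star y = y by rewrite star_realZ ss.
have -> : t%:C *: (1 : U) - s * s = t%:C *: (1 - y * y).
  rewrite scalerBr; congr (_ - _).
  rewrite /y scaleMl scaleMr !scalerA -!(rmorphM (real_complex R)) rr /=.
  have -> : r * r * (r^-1 / r) = 1 by field; rewrite gt_eqF.
  by rewrite scale1r.
by rewrite rnormZr ?(ltW t0)// ler_piMr ?(ltW t0)// rnorm_one_sub_sqr.
Qed.

Lemma pos_sqrt x : pos x -> exists s : U,
  [/\ pos s, s * s = x & forall y, GRing.comm y x -> GRing.comm y s].
Proof.
move=> px; have := pos_dist px (lexx _).
case/(pos_root_of_dist (pos_sa px) (rnorm_ge0 x)) => s [ss sx d c].
exists s; split=> //.
have [r [sr rs _ _]] := pos_root_of_dist ss (sqrtr_ge0 _) d.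
by exists r.
Qed.

Lemma pos_of_dist x t :
  star x = x -> 0 <= t -> rnorm (t%:C *: (1 : U) - x) <= t -> pos x.
Proof. by move=> sx t0 /(pos_root_of_dist sx t0)[s [ss <- _ _]]; exists s. Qed.

(** The test ||t - x|| <= t is subadditive in (t, x). *)
Lemma posD x y : pos x -> pos y -> pos (x + y).
Proof.
move=> px py; apply: (@pos_of_dist _ (rnorm x + rnorm y)).
- by rewrite starD !pos_sa.
- by rewrite addr_ge0 ?rnorm_ge0.
rewrite rmorphD scalerDl opprD addrACA (le_trans (rnormD _ _))//.
by rewrite lerD// pos_dist.
Qed.

Lemma posZ t x : 0 <= t -> pos x -> pos (t%:C *: x).
Proof.
move=> t0 [s ss ->]; exists ((Num.sqrt t)%:C *: s); first by rewrite star_realZ ss.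
rewrite scaleMl scaleMr scalerA -(rmorphM (real_complex R)).
by rewrite -[Num.sqrt t * _]expr2 sqr_sqrtr.
Qed.

(** The roots of a and of t - a commute, and their squares add up to t. *)
Lemma pos_le_scalar (a : U) t :
  0 <= t -> pos a -> pos (t%:C *: (1 : U) - a) -> rnorm a <= t.
Proof.
move=> t0 pa /pos_sqrt[c [/pos_sa sc cc cP]].
have [d [/pos_sa sd dd dP]] := pos_sqrt pa.
rewrite -dd rnorm_sa_sqr//; apply: (@rnorm_summand_sqr c d) => //.
  apply/commr_sym/cP/commrB; first exact: comm_scalar.
  exact/commr_sym/dP/commr_refl.
by rewrite cc dd subrK.
Qed.

Lemma pos_scalar_norm (b : U) : pos b -> pos ((rnorm b)%:C *: (1 : U) - b).
Proof.
move=> pb; apply: (@pos_of_dist _ (rnorm b)) => //; last 1 first.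
- by rewrite opprB addrC subrK.
- by rewrite starB star_scalar pos_sa.
- exact: rnorm_ge0.
Qed.

Lemma pos_rnorm_le (a b : U) : pos a -> pos (b - a) -> rnorm a <= rnorm b.
Proof.
move=> pa pba; apply: pos_le_scalar => //; first exact: rnorm_ge0.
have pb : pos b by rewrite -(subrK a b); exact: posD.
have -> : (rnorm b)%:C *: (1 : U) - a = ((rnorm b)%:C *: (1 : U) - b) + (b - a).
  by rewrite addrA subrK.
exact/posD/pba/pos_scalar_norm.
Qed.

Lemma pos_anti x : pos x -> pos (- x) -> x = 0.
Proof.
move=> px pNx; apply: rnorm_eq0; apply/le_anti; rewrite rnorm_ge0 andbT -(@rnorm0 R U).
by apply: pos_rnorm_le => //; rewrite sub0r.
Qed.

End order.

(** * Positivity of y^* y *)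

Section gram.
Context {R : realType} {A : cstarType R} {J : ideal A}.
Notation U := (multiplier J).
Implicit Types x y w : U.

(** Twice the sum of the squares of the real and imaginary parts of w. *)
Lemma pos_star_gram_sum w : pos (star w * w + w * star w).
Proof.
have [k conjk kk] := imaginary_unit R.
pose h : U := w + star w; pose g : U := k *: (w - star w).
have sh : star h = h by rewrite starD starK addrC.
have sg : star g = g by rewrite starZ starB starK conjk scaleNr -scalerN opprB.
have -> : star w * w + w * star w = (2^-1)%:C *: (h * h + g * g).
  have -> : h * h + g * g = (star w * w + w * star w) + (star w * w + w * star w).
    rewrite /g scaleMl scaleMr scalerA kk scaleN1r /h.
    have E (a b c d : U) : a + b + (c + d) - (a - b - (c - d)) = c + b + (c + b).
      have F (u v : U) : u + v + (u - v) = u + u by rewrite addrACA subrr addr0.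
      by rewrite !opprB [c - d + _]addrC addrACA [a + b]addrC !F addrC addrACA.
    rewrite -(E (w * w) _ _ (star w * star w)) mulrBl !mulrBr.
    by rewrite mulrDl !mulrDr.
  rewrite scalerDr -scalerDl -(rmorphD (real_complex R)) -[LHS]scale1r.
  by congr (_%:C *: _); lra.
by apply: posZ; [rewrite invr_ge0|apply: posD; [exists h|exists g]].
Qed.

(** Here d = w w^* is positive by [pos_star_gram_sum], while w p^2 = - d w.
    With tau = ||w||^2 = ||d|| = ||p^2|| and z = 1 + p^2 / tau this gives
    w z = (1 - d / tau) w, of norm at most ||w|| since d is positive.  But
    (w z)^* (w z) = - (p z)^2, and (p z)^2 >= 2 p^4 / tau has norm at least
    2 tau, so 2 tau <= tau.  This replaces comparing the spectra of w^* w and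
    w w^*. *)
Lemma gram_neg_sqr_eq0 w (p : U) : star p = p -> star w * w = - (p * p) -> w = 0.
Proof.
move=> sp wp; apply/eqP; apply/negPn/negP => /rnorm_gt0 w0.
pose d := w * star w; pose tau := rnorm w ^+ 2.
have tau0 : 0 < tau by rewrite exprn_gt0.
have pd : pos d.
  have -> : d = (star w * w + w * star w) + p * p.
    by rewrite wp addrAC addNr add0r.
  by apply: posD; [exact: pos_star_gram_sum|exists p].
have nd : rnorm d = tau.
  by rewrite /d -{1}(starK w) rnorm_cstar_r rnorm_star.
have np : rnorm (p * p) = tau by rewrite -rnormN -wp rnorm_cstar_r.
pose a := tau^-1%:C *: (p * p).
have cpa : p * a = a * p by rewrite scaleMl scaleMr mulrA.
have sa : star a = a by rewrite star_realZ starMr sp.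
pose z := 1 + a; pose q := p * z.
have sz : star z = z by rewrite starD star1 sa.
have pz : p * z = z * p by rewrite mulrDr mulrDl cpa mulr1 mul1r.
have wz : w * z = (1 - tau^-1%:C *: d) * w.
  rewrite mulrDr mulr1 mulrBl mul1r; congr (_ + _).
  by rewrite scaleMr scaleMl /d -mulrA wp mulrN scalerN opprK.
have nwz : rnorm (w * z) <= rnorm w.
  rewrite wz (le_trans (rnormMr _ _))// ler_piMl ?rnorm_ge0//.
  have -> : 1 - tau^-1%:C *: d = tau^-1%:C *: (tau%:C *: (1 : U) - d).
    by rewrite scalerBr scalerA -(rmorphM (real_complex R)) mulVf ?gt_eqF// scale1r.
  rewrite rnormZr ?invr_ge0 ?(ltW tau0)// mulrC ler_pdivrMr// mul1r.
  by apply: pos_dist => //; rewrite nd.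
have nqq : rnorm (q * q) <= tau.
  have -> : q * q = - (star (w * z) * (w * z)).
    rewrite starMr sz -mulrA [star w * _]mulrA wp !mulNr mulrN opprK.
    by rewrite {1}/q pz /q -!mulrA.
  rewrite rnormN rnorm_cstar_r.
  by rewrite lerXn2r ?nnegrE ?rnorm_ge0.
have : rnorm (p * p * a + p * p * a) <= rnorm (q * q).
  apply: pos_rnorm_le.
    have : pos (p * p * a).
      exists ((Num.sqrt tau^-1)%:C *: (p * p)).
        by rewrite star_realZ starMr sp.
      rewrite !(scaleMl, scaleMr) scalerA -(rmorphM (real_complex R)).
      by rewrite -[Num.sqrt _ * _]expr2 sqr_sqrtr ?invr_ge0 ?(ltW tau0).
    by move=> h; exact: posD.
  have -> : q * q - (p * p * a + p * p * a) = p * p + (p * a) * (p * a).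
    have -> : q = p + p * a by rewrite /q mulrDr mulr1.
    rewrite mulrDl !mulrDr.
    have -> : p * a * p = p * p * a by rewrite -mulrA -cpa mulrA.
    rewrite [p * (p * a)]mulrA.
    by rewrite [p * p * a + p * a * _]addrC addrACA addrK.
  apply: posD; first by exists p.
  by exists (p * a) => //; rewrite starMr sp sa cpa.
have -> : p * p * a + p * p * a = (2 / tau)%:C *: ((p * p) * (p * p)).
  rewrite /a scaleMr -scalerDl -(rmorphD (real_complex R)).
  by congr (_%:C *: _); field; rewrite gt_eqF.
rewrite rnormZr ?divr_ge0 ?(ltW tau0)// rnorm_sa_sqr ?starMr ?sp// np => h.
have : 2 / tau * tau ^+ 2 = 2 * tau by field; rewrite gt_eqF.
by move: h nqq tau0; lra.
Qed.

(** Kaplansky's argument.  For a = y^* y, s = |a| and b = s - a, the relation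
    a b = - s b makes (y b)^* (y b) = b a b = - s b^2 the opposite of a square,
    so y b = 0; then a b = 0 and s b = 0, whence b^2 = 0 and a = s. *)
Lemma pos_gram y : pos (star y * y).
Proof.
pose a := star y * y.
have sa : star a = a by rewrite starMr starK.
have [s [ps ss sc]] : exists s : U, [/\ pos s, s * s = a * a &
    forall y, GRing.comm y (a * a) -> GRing.comm y s].
  by apply: pos_sqrt; exists a.
have cas : a * s = s * a by apply/sc/commrM.
have [r [pr rr rc]] := pos_sqrt ps.
have sS := pos_sa ps.
pose b := s - a.
have sb : star b = b by rewrite starB sS sa.
have crb : b * r = r * b.
  by apply/rc/commr_sym/commrB.
have ab : a * b = - (s * b).
  by rewrite !mulrBr -ss cas opprB.
have w0 : y * b = 0.
  apply: (@gram_neg_sqr_eq0 _ (r * b)).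
    by rewrite starMr sb pos_sa.
  rewrite starMr sb mulrA -[b * _ * _]mulrA -/a -mulrA ab mulrN -rr.
  by rewrite !mulrA crb.
have ab0 : a * b = 0 by rewrite /a -mulrA w0 mulr0.
have b0 : b = 0.
  apply: rnorm_eq0; apply/eqP; rewrite -sqrf_eq0 -(rnorm_sa_sqr sb).
  rewrite {1}/b mulrBl ab0 subr0 -[s * b]opprK -ab ab0 oppr0 rnorm0.
  by [].
have -> : star y * y = s by apply/eqP; rewrite eq_sym -subr_eq0; apply/eqP.
by [].
Qed.

Lemma pos_conj x (a : U) : pos a -> pos (star x * a * x).
Proof.
case=> s ss ->; have := pos_gram (s * x).
by rewrite starMr ss !mulrA.
Qed.

Lemma gram_sum_eq0 y w : star y * y + star w * w = 0 -> y = 0.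
Proof.
move=> /eqP; rewrite addrC addr_eq0 => /eqP E.
have : star y * y = 0.
  by apply: pos_anti; [exact: pos_gram|rewrite -E; exact: pos_gram].
move=> yy; apply: rnorm_eq0; apply/eqP; rewrite -sqrf_eq0 -rnorm_cstar_r.
by rewrite yy rnorm0.
Qed.

End gram.

(** * Hereditary subalgebras cut out by a multiplier *)

Section spectral_corner.
Context {R : realType} {A : cstarType R} {J : ideal A}.
Notation U := (multiplier J).
Notation L := (lmul : A -> U).

Lemma lmulB : {morph L : x y / x - y}.
Proof.
move=> x y; apply: multiplier_ext => a; apply/val_inj.
by rewrite /= cmulBl scaleN1r.
Qed.

Lemma lmulM x y : L (x ** y) = L x * L y.
Proof. by apply: multiplier_ext => a; apply/val_inj; rewrite /= -cmulA. Qed.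

Lemma lmul_star x : L (star x) = star (L x).
Proof. exact: multiplier_ext. Qed.

Lemma lmulD x y : L (x + y) = L x + L y.
Proof.
by move: (lmulB (x + y) y); rewrite addrK => ->; rewrite subrK.
Qed.

Lemma lmul0 : L 0 = 0.
Proof. by move: (lmulB 0 0); rewrite !subrr. Qed.

Lemma lmulZ k x : L (k *: x) = k *: L x.
Proof. by apply: multiplier_ext => a; apply/val_inj; rewrite /= cmulZl. Qed.

(** Multipliers of J commute with right multiplications. *)
Lemma lmul_app (f : U) (c : J) : L (val (f c)) = f * L (val c).
Proof.
apply: multiplier_ext => a; apply: ideal_nondegenerate => b.
by rewrite [RHS]madjP /= !starM -!cmulA madjP.
Qed.

Lemma positive_lmul x : positive_elt x -> pos (L x).
Proof. by case=> y ->; rewrite lmulM lmul_star; exact: pos_gram. Qed.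

Hypothesis L_isometry : forall a, rnorm (L a) = rnorm a.

Definition annihilator_corner (g : U) : set A :=
  [set x | g * L x = 0 /\ L x * g = 0].

(** Heredity: if a = y^* y and d - a = z^* z, the two positive elements
    (y g)^* (y g) and (z g)^* (z g) add up to g d g = 0. *)
Lemma annihilator_corner_hereditary (g : U) : star g = g ->
  hereditary_subalgebra (annihilator_corner g).
Proof.
move=> sg; split.
- apply: closedI.
  + apply: (@closed_ker _ _ _ (fun x => g * L x) (rnorm g)).
      by move=> u v; rewrite lmulB mulrBr.
    by move=> u; rewrite (le_trans (rnormMr _ _))// L_isometry.
  + apply: (@closed_ker _ _ _ (fun x => L x * g) (rnorm g)).
      by move=> u v; rewrite lmulB mulrBl.
    by move=> u; rewrite (le_trans (rnormMr _ _))// L_isometry mulrC.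
- by rewrite /annihilator_corner /= lmul0 mulr0 mul0r.
- move=> x y [gx xg] [gy yg]; rewrite /annihilator_corner /= lmulD.
  by rewrite mulrDl mulrDr gx xg gy yg addr0.
- move=> k x [gx xg]; rewrite /annihilator_corner /= lmulZ.
  by rewrite scaleMl scaleMr gx xg scaler0.
- move=> x y [gx xg] [gy yg]; rewrite /annihilator_corner /= lmulM.
  by rewrite mulrA gx mul0r -mulrA yg mulr0.
- move=> x [gx xg]; rewrite /annihilator_corner /= lmul_star.
  by rewrite -sg -!starMr gx xg star0.
- move=> a d [gd dg] [y ay] [z daz].
  have yg0 : L y * g = 0.
    apply: (@gram_sum_eq0 _ _ _ _ (L z * g)).
    rewrite !starMr sg !mulrA -!(mulrA g) -!lmul_star -!lmulM -ay -daz.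
    by rewrite -mulrDr -mulrDl -lmulD addrC subrK dg mulr0.
  have ag : L a * g = 0 by rewrite ay lmulM -mulrA yg0 mulr0.
  split=> //.
  apply: (inv_inj (@starK R U)).
  by rewrite starMr star0 sg -lmul_star ay starM starK -ay ag.
Qed.

(** For k = m - lam, the corner annihilated by |k| - k contains f J f with
    f = |k| + k; as lam < ||m||, k is not negative, so f is not 0. *)
Lemma spectral_corner (m : U) (lam : R) : pos m -> 0 <= lam -> lam < rnorm m ->
  exists D : set A, [/\ hereditary_subalgebra D, exists2 d, D d & d != 0 &
    forall x, D x -> positive_elt x -> rnorm x = 1 ->
      lam <= rnorm (L x * m * L x)].
Proof.
move=> pm lam0 lamm.
pose k : U := m - lam%:C *: (1 : U).
have sk : star k = k by rewrite starB star_scalar pos_sa.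
have [s [ps ss sc]] : exists s : U, [/\ pos s, s * s = k * k &
    forall y, GRing.comm y (k * k) -> GRing.comm y s].
  by apply: pos_sqrt; exists k.
have cks : k * s = s * k by apply/sc/commrM.
have sS := pos_sa ps.
pose g := s - k; pose f := s + k.
have sg : star g = g by rewrite starB sS sk.
have sf : star f = f by rewrite starD sS sk.
have gf : g * f = 0.
  rewrite /g /f; move: cks ss; move: (k : U) => l cls ss.
  by rewrite mulrBl !mulrDr cls ss [l * l + _]addrC subrr.
have fg : f * g = 0 by rewrite -sf -sg -starMr gf star0.
have f0 : f != 0.
  apply/eqP => fE; have skE : s = - k by apply/eqP; rewrite -addr_eq0 -/f fE.
  move: lamm; rewrite ltNge => /negP; apply; apply: pos_le_scalar => //.
  by rewrite -opprB -/k -skE.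
have [c fc] : exists c : J, val (f c) != 0.
  apply: contrapT => h; case/eqP: f0; apply: multiplier_ext => a; apply/val_inj.
  by apply/eqP/negPn/negP => fa; apply: h; exists a.
exists (annihilator_corner g); split.
- exact: annihilator_corner_hereditary.
(* This x is f c c^* f as a multiplier, with f c in J since J is an ideal
   of M(J). *)
- exists (val (f c) ** star (val (f c))).
    have E : L (val (f c) ** star (val (f c))) = f * L (val c) * star (L (val c)) * f.
      by rewrite lmulM lmul_star lmul_app starMr sf mulrA.
    by split; rewrite E; [rewrite !mulrA gf !mul0r|rewrite -mulrA fg mulr0].
  apply: contra fc => /eqP h; apply/eqP/rnorm_eq0/eqP.
  by rewrite -rnorm_star -sqrf_eq0 -rnorm_cstar starK h rnorm0.
- move=> x [gx _] px x1.
  have sx : star (L x) = L x by exact/pos_sa/positive_lmul.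
  have kx : s * L x = k * L x by apply/eqP; rewrite -subr_eq0 -mulrBl gx.
  have pp : pos (L x * m * L x - lam%:C *: (L x * L x)).
    have -> : L x * m * L x - lam%:C *: (L x * L x) = star (L x) * s * L x.
      rewrite sx -[RHS]mulrA kx mulrA mulrBr mulrBl.
      by rewrite scaleMr mulr1 scaleMl.
    exact: pos_conj.
  have := pos_rnorm_le (posZ lam0 (ex_intro2 _ _ (L x) sx erefl)) pp.
  by rewrite rnormZr// rnorm_sa_sqr// L_isometry x1 expr1n mulr1.
Qed.

End spectral_corner.

(** * Expectations *)

Section expectations.
Context {R : realType} {A B : cstarType R}.

(** Complete positivity for matrices of size 1. *)
Lemma cp_positive_elt (C : cstarType R) (E : B -> C) b :
  completely_positive E -> positive_elt b -> positive_elt (E b).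
Proof.
move=> [_ cpE] [c bc].
have /cpE[Y /matrixP/(_ ord0 ord0)] : mx_positive (const_mx b : 'M[B]_1).
  by exists (const_mx c); apply/matrixP => i j; rewrite !mxE big_ord1 !mxE.
by rewrite !mxE big_ord1 => ->; exists (Y ord0 ord0).
Qed.

Lemma rnorm_gram_dist (C : cstarType R) (y n : C) : rnorm (y - n) <= 1 ->
  rnorm (star y ** y - star n ** n) <= (2 * rnorm y + 1) * rnorm (y - n).
Proof.
move=> yn1.
have -> : star y ** y - star n ** n = star y ** (y - n) + star (y - n) ** n.
  by rewrite cmulBr starB cmulBl addrA subrK.
have ny : rnorm n <= rnorm y + 1.
  have := rnormD y (- (y - n)); rewrite rnormN opprB addrC subrK; lra.
have := rnormD (star y ** (y - n)) (star (y - n) ** n).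
have := rnormM (star y) (y - n); have := rnormM (star (y - n)) n.
rewrite !rnorm_star.
have := ler_wpM2l (rnorm_ge0 (y - n)) ny.
by lra.
Qed.

Lemma incl_rnorm (C D : cstarType R) (i : cstar_inclusion C D) x :
  rnorm (i x) = rnorm x.
Proof. by rewrite /rnorm incl_norm. Qed.

(** A third of ||e|| leaves room for ||m|| > 2 eps, so that lam = 2 eps can be
    used for m = n^* n and eps be lost in passing from m to e. *)
Lemma approx_bounded_below (C : cstarType R) (j : cstar_inclusion A C)
    (J : ideal A) (h : cstar_inclusion (multiplier J) C) (e : C) (n : multiplier J)
    (eps : R) :
  (forall a, j a = h (lmul a)) ->
  rnorm (e - h (star n ** n)) <= eps -> 0 <= eps -> 3 * eps < rnorm e ->
  exists D : set A, [/\ hereditary_subalgebra D, exists2 d, D d & d != 0 &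
    forall x, D x -> positive_elt x -> `|x| = 1 ->
      eps%:C <= `|j x ** e ** j x|].
Proof.
move=> jh em eps0 epse.
pose m := star n ** n.
have Liso a : rnorm (lmul a : multiplier J) = rnorm a.
  by rewrite -(incl_rnorm h) -jh incl_rnorm.
have mbig : 2 * eps < rnorm m.
  have := rnormD (e - h m) (h m); rewrite subrK incl_rnorm -/m in em *; lra.
have pm : pos m by exact: pos_gram.
have [|D [Dh D0 DP]] := spectral_corner Liso pm _ mbig; first by rewrite mulr_ge0.
exists D; split=> // x Dx px x1.
have {}x1 : rnorm x = 1 by rewrite /rnorm x1.
rewrite rnormE lecR.
have H1 := DP x Dx px x1.
have H2 : rnorm (j x ** (e - h m) ** j x) <= eps.
  rewrite (le_trans (rnormM _ _))// incl_rnorm x1 mulr1.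
  by rewrite (le_trans (rnormM _ _))// incl_rnorm x1 mul1r.
have E : j x ** e ** j x = h (lmul x ** m ** lmul x) + j x ** (e - h m) ** j x.
  by rewrite cmulBr cmulBl !incl_mul -!jh addrC subrK.
have := rnormD (j x ** e ** j x) (- (j x ** (e - h m) ** j x)).
rewrite rnormN {1}E addrK incl_rnorm mulE.
move: H1 H2; rewrite !mulE; lra.
Qed.

End expectations.

Theorem proposition5p22 (R : realType) (A B : cstarType R) (i : cstar_inclusion A B) :
  (forall (M : local_multiplier_algebra A) (E : B -> M),
     mloc_expectation i E -> supportive (mloc_inclusion M) E) /\
  (forall E : B -> A,
     conditional_expectation i E -> supportive (id_inclusion A) E).
Proof.
split.
- move=> M E [cpE _ _] b pb /rnorm_gt0 Eb0.
  have [y Eby] := cp_positive_elt cpE pb.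
  set eps := rnorm (E b) / 4.
  have eps0 : 0 < eps by rewrite divr_gt0.
  pose K := 2 * rnorm y + 1.
  have K0 : 0 < K by have := rnorm_ge0 y; rewrite /K; lra.
  pose theta := Num.min 1 (eps / K).
  have theta0 : 0 < theta by rewrite lt_min ltr01 divr_gt0.
  have : closure [set x | exists (J : ideal A) (eJ : essential J)
      (n : multiplier J), x = mloc_in M eJ n] y by rewrite mloc_dense.
  move=> /(_ (ball y theta%:C))[|_ [[J [eJ [n ->]]]]].
    by apply: nbhsx_ballx; rewrite ltcR.
  rewrite -ball_normE /= rnormE ltcR => yn.
  have yn1 : rnorm (y - mloc_in M eJ n) <= 1.
    by rewrite (le_trans (ltW yn))// ge_min lexx.
  have ynK : rnorm (y - mloc_in M eJ n) <= eps / K.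
    by rewrite (le_trans (ltW yn))// ge_min lexx orbT.
  have [||||D [Dh D0 DP]] := @approx_bounded_below _ _ _ (mloc_inclusion M) J
    (mloc_in M eJ) (E b) n eps.
  + exact: mloc_inclusionE.
  + rewrite Eby incl_mul incl_star (le_trans (rnorm_gram_dist yn1))//.
    by rewrite mulrC -ler_pdivlMr.
  + exact: ltW.
  + by rewrite /eps; lra.
  by exists eps, D.
- move=> E [cpE _ _] b pb /rnorm_gt0 Eb0.
  have [y Eby] := cp_positive_elt cpE pb.
  have Liso (a : A) : rnorm (lmul_inclusion a) = rnorm a by exact: incl_rnorm.
  have pEb : pos (lmul_inclusion (E b)) by rewrite /=; apply: positive_lmul; exists y.
  have [||D [Dh D0 DP]] := @spectral_corner _ _ _ Liso _ (rnorm (E b) / 2) pEb.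
  + by rewrite divr_ge0 ?rnorm_ge0.
  + by rewrite Liso; lra.
  exists (rnorm (E b) / 2), D; split=> //; first by rewrite divr_gt0.
  move=> x Dx px x1; have {}x1 : rnorm x = 1 by rewrite /rnorm x1.
  rewrite rnormE lecR -[leRHS]Liso /= !lmulM.
  exact: DP.
Qed.
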